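(* Let $p$ be an odd prime and let $q$ be a prime power such that $p$ divides $q-1$ but $p^2$ does not divide $q-1$. If $1<n<p$, then $\mathrm{GL}(n,q)$ does not have a redundant Sylow $p$-subgroup, and $\mathrm{GL}(p,q)$ has a redundant Sylow $p$-subgroup.
   Context: For a finite group $G$ and a prime $p$, $G_p$ denotes the set of $p$-elements of $G$ and $\mathrm{Syl}_p(G)$ the set of Sylow $p$-subgroups of $G$. $G$ is said to have a redundant Sylow $p$-subgroup if $G_p$ is contained in the union of the members of some proper subset of $\mathrm{Syl}_p(G)$. *)

(* Defs.v *)
From mathcomp Require Import all_boot all_order all_algebra all_fingroup all_solvable all_field.
Set Implicit Arguments. Unset Strict Implicit. Unset Printing Implicit Defensive.

Local Open Scope group_scope.

Definition p_elements (gT : finGroupType) (p : nat) (G : {set gT}) : {set gT} :=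
  [set x in G | p.-elt x].

Definition has_redundant_Sylow (gT : finGroupType) (p : nat) (G : {group gT}) : Prop :=
  exists2 S : {set {group gT}}, S \proper 'Syl_p(G) &
    p_elements p G \subset \bigcup_(P in S) P.

(* Main.v *)
(** Let D be the group of diagonal matrices u with u^p = 1, of order p^n.
    Comparing with |GL(n,q)|, D is a Sylow p-subgroup for n < p, and an element
    of D with distinct eigenvalues commutes only with diagonal matrices, hence
    lies in no other (abelian) Sylow subgroup.
    For n = p, a Sylow p-subgroup is P = D<sigma>, with sigma a p-cycle
    permutation matrix.  Conjugates of D inside P equal D, because elements of
    P outside D centralize only scalars in D.  Suppose P were the only Sylow
    subgroup containing some x.  If x^p = 1, then x is diagonalizable, hence
    in D; a transvection centralizing x (repeated eigenvalue) or a Vandermonde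
    matrix conjugating x to sigma^-1 (distinct eigenvalues) gives another Sylow
    subgroup.  If x^p <> 1, then x^p is a scalar other than 1, so x - 1 is
    invertible; it centralizes x but does not normalize D. *)
Require Import Defs.
From mathcomp Require Import all_boot all_order all_algebra all_fingroup all_solvable all_field.
From mathcomp Require Import ring.
Set Implicit Arguments. Unset Strict Implicit. Unset Printing Implicit Defensive.
Import GRing.Theory.

(** * Arithmetic: powers of p dividing the numbers q^n - 1 *)

Section PPart.

Variables p q : nat.
Hypotheses (p_prime : prime p) (p_odd : odd p).
Hypotheses (q_gt1 : 1 < q) (p_dvd : p %| q.-1) (p2_ndvd : ~~ (p ^ 2 %| q.-1)).

Let q1_gt0 : 0 < q.-1. Proof. by case: q q_gt1 => [|[]]. Qed.

Lemma logn_predn_eq1 : logn p q.-1 = 1.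
Proof.
apply/eqP; rewrite eqn_leq -(pfactor_dvdn 1) // expn1 p_dvd andbT.
by rewrite leqNgt -pfactor_dvdn.
Qed.

(** Binomial expansion of (1 + (q - 1))^j: from the quadratic term on, everything is divisible by (q
    - 1)^2, hence by p^2. *)
Lemma expn_mod_sq j : exists c, q ^ j = 1 + j * q.-1 + c * p ^ 2.
Proof.
have [k kE] := dvdnP p_dvd.
have qE : q = k * p + 1 by rewrite -kE addn1 prednK // ltnW.
elim: j => [|j [c IHj]]; first by exists 0; rewrite !mul0n.
exists (c * q + j * k ^ 2); rewrite expnS IHj kE qE; ring.
Qed.

Lemma sum_expn_mod_sq n :
  exists c, \sum_(j < n) q ^ j = n + 'C(n, 2) * q.-1 + c * p ^ 2.
Proof.
elim: n => [|n [c IHn]]; first by exists 0; rewrite big_ord0.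
have [d dE] := expn_mod_sq n.
by exists (c + d); rewrite big_ord_recr /= IHn dE binS bin1; ring.
Qed.

Lemma sum_expn_gt0 n : 0 < n -> 0 < \sum_(j < n) q ^ j.
Proof. by case: n => // n _; rewrite big_ord_recl expn0. Qed.

(** Modulo p^2 the sum is n + C(n,2)(q - 1), and p divides q - 1. For n < p it is n modulo p, hence
    prime to p. For n = p, p also divides C(p,2), so the sum is p times a number congruent to 1
    modulo p. *)
Lemma logn_sum_expn n : 0 < n <= p ->
  logn p (\sum_(j < n) q ^ j) = (n == p).
Proof.
case/andP=> n_gt0 n_le; have [c sumE] := sum_expn_mod_sq n.
have s_gt0 := sum_expn_gt0 n_gt0.
case: (eqVneq n p) => [np | n_neq].
  have [k kE] := dvdnP p_dvd.
  have /dvdnP[b bE] : p %| 'C(n, 2).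
    rewrite np; apply: prime_dvd_bin => //=.
    (* Divisibility of C(p,2) by p requires 2 < p; this is where p odd enters. *)
    by rewrite ltn_neqAle prime_gt1 // andbT; apply: contraTneq p_odd => <-.
  have {}sumE : \sum_(j < n) q ^ j = p * (1 + (b * k + c) * p).
    by rewrite sumE bE kE np; ring.
  rewrite sumE (lognM _ (prime_gt0 p_prime)) // logn_prime // eqxx /= lognE p_prime /=.
  by rewrite dvdn_addl ?dvdn_mull // dvdn1 (gtn_eqF (prime_gt1 p_prime)).
apply/eqP; rewrite /= -leqn0 leqNgt -(pfactor_dvdn 1) // expn1 sumE.
rewrite dvdn_addl ?dvdn_addl; last 2 first.
- by rewrite dvdn_mull.
- by rewrite dvdn_mull // expnS dvdn_mulr.
by rewrite gtnNdvd // ltn_neqAle n_neq.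
Qed.

Lemma logn_expn_sub1 n : 0 < n <= p -> logn p (q ^ n - 1) = (n == p).+1.
Proof.
move=> n_bnd; rewrite subn1 predn_exp lognM //; last first.
  by apply: sum_expn_gt0; case/andP: n_bnd.
by rewrite logn_predn_eq1 logn_sum_expn.
Qed.

Lemma logn_prod_expn_sub1 n : n <= p ->
  logn p (\prod_(1 <= i < n.+1) (q ^ i - 1)) = n + (n == p).
Proof.
elim: n => [|n IHn] n_le; first by rewrite big_geq // logn1 eq_sym (gtn_eqF (prime_gt0 p_prime)).
have pos i : 0 < i -> 0 < q ^ i - 1 by move=> i_gt0; rewrite subn_gt0 -(exp1n i) ltn_exp2r.
rewrite big_nat_recr //= lognM ?pos //; last first.
  by rewrite big_nat; apply: prodn_cond_gt0 => i /andP[/pos].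
rewrite IHn 1?ltnW // logn_expn_sub1 // (ltn_eqF n_le) addn0; by rewrite addnS addSn.
Qed.

Lemma coprime_of_dvd_predn : coprime p q.
Proof.
have [k kE] := dvdnP p_dvd.
have -> : q = k * p + 1 by rewrite -kE addn1 prednK // ltnW.
by rewrite /coprime gcdnC -gcdn_modl modnMDl gcdn_modl gcd1n.
Qed.

End PPart.

(** * Order of a Sylow p-subgroup of GL(n,q), and p-th roots of unity *)

Section GLcard.

Variables (p : nat) (F : finFieldType).
Hypotheses (p_prime : prime p) (p_odd : odd p).
Hypotheses (p_dvd : p %| #|F|.-1) (p2_ndvd : ~~ (p ^ 2 %| #|F|.-1)).

(** The power of q in the order is prime to p, and each factor q^i - 1 contributes one p, with a
    second one only for i = p. *)
Lemma p_part_GL n : 0 < n <= p -> #|'GL_n[F]%g|`_p = p ^ (n + (n == p)).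
Proof.
case/andP=> n_gt0 n_le; have F_gt1 := finNzRing_gt1 F.
rewrite p_part card_GL // lognM; last 2 first.
- by rewrite expn_gt0 ltnW.
- by rewrite big_nat; apply: prodn_cond_gt0 => i /andP[i_gt0 _]; rewrite subn_gt0 -(exp1n i) ltn_exp2r.
rewrite logn_prod_expn_sub1 // lognX logn_coprime ?muln0 //.
exact: coprime_of_dvd_predn.
Qed.

(** Cauchy's theorem in the unit group of F, whose order q - 1 is divisible by p. *)
Lemma exists_prim_root : exists w : F, (p.-primitive_root w)%R.
Proof.
have := @Cauchy _ p [group of [set: {unit F}]] p_prime.
rewrite card_finField_unit => /(_ p_dvd) [z _ z_ord].
have zp : (val z ^+ p = 1)%R by rewrite -FinRing.val_unitX -z_ord expg_order.
have [m m_prim] := prim_order_exists (prime_gt0 p_prime) zp.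
move/(primeP p_prime).2/orP=> -[] /eqP mE; last by exists (val z); rewrite -mE.
have /eqP : z = 1%g by apply: val_inj; rewrite /= -(prim_expr_order m_prim) mE.
by rewrite -order_eq1 z_ord (gtn_eqF (prime_gt1 p_prime)).
Qed.

End GLcard.

(** * The diagonal matrices of exponent p *)

Section Diagonal.

Variables (p m : nat) (F : finFieldType).
Hypotheses (p_prime : prime p) (p_dvd : p %| #|F|.-1).

Local Open Scope group_scope.
Local Notation gT := {'GL_m.+1[F]}.
Local Notation mx u := (GLval u : 'M[F]_m.+1).

Definition diag_torsion : {set gT} :=
  [set u : gT | is_diag_mx (mx u) & u ^+ p == 1].

Lemma in_diag_torsion u :
  (u \in diag_torsion) = is_diag_mx (mx u) && (u ^+ p == 1).
Proof. by rewrite inE. Qed.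

Lemma GLval_inj : injective (@GLval m.+1 F).
Proof. exact: val_inj. Qed.

Lemma GLvalX (u : gT) k : mx (u ^+ k) = (mx u ^+ k)%R.
Proof. by elim: k => // k IHk; rewrite expgS exprS -IHk. Qed.

Lemma GLval_onto (A : 'M[F]_m.+1) : A \in unitmx -> exists u : gT, mx u = A.
Proof. by move=> uA; exists (Sub A uA : gT). Qed.

Lemma diag_mxX n (d : 'rV[F]_n.+1) k :
  (diag_mx d ^+ k = diag_mx (\row_i d 0 i ^+ k))%R.
Proof.
elim: k => [|k IHk].
  rewrite expr0; apply: (etrans (esym (@diag_const_mx F n.+1 1%R))); congr diag_mx.
  by apply/rowP=> i; rewrite !mxE.
rewrite exprS IHk [LHS]mulmx_diag; congr diag_mx.
by apply/rowP=> i; rewrite !mxE exprS.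
Qed.

Lemma diag_torsionP (u : gT) :
  reflect (exists2 d : 'rV[F]_m.+1, mx u = diag_mx d & forall i, (d 0 i ^+ p = 1)%R)
          (u \in diag_torsion).
Proof.
rewrite in_diag_torsion; apply: (iffP andP) => [[/diag_mxP[d uE] /eqP up] | [d uE dp]].
  exists d => // i; have := congr1 (fun v : gT => mx v i i) up.
  by rewrite GLvalX uE diag_mxX !mxE eqxx.
split; first by apply/diag_mxP; exists d.
apply/eqP/GLval_inj; rewrite GLvalX uE diag_mxX.
apply: etrans (@diag_const_mx F m.+1 1%R).
by congr diag_mx; apply/rowP=> i; rewrite !mxE.
Qed.

Lemma diag_torsionX u : u \in diag_torsion -> u ^+ p = 1.
Proof. by rewrite in_diag_torsion => /andP[_ /eqP]. Qed.

Lemma diag_torsion_commute : {in diag_torsion &, commutative mulg}.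
Proof.
move=> u v /diag_torsionP[d uE _] /diag_torsionP[e vE _].
by apply: GLval_inj; rewrite !GL_ME uE vE; apply: diag_mxC.
Qed.

Lemma group_set_diag_torsion : group_set diag_torsion.
Proof.
apply/group_setP; split.
  by rewrite in_diag_torsion expg1n eqxx andbT; apply: scalar_mx_is_diag.
move=> u v Du Dv; have uvC := diag_torsion_commute Du Dv.
move: Du Dv; rewrite !in_diag_torsion => /andP[/diag_mxP[d uE] /eqP up] /andP[/diag_mxP[e vE] /eqP vp].
rewrite expgMn // up vp mulg1 eqxx andbT GL_ME uE vE [X in is_diag_mx X]mulmx_diag.
exact: diag_mx_is_diag.
Qed.

Canonical diag_torsion_group := Group group_set_diag_torsion.

Lemma abelian_diag_torsion : abelian diag_torsion.
Proof. by apply/centsP=> u Du v Dv; apply: diag_torsion_commute. Qed.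

Lemma diag_torsion_onto (d : 'rV[F]_m.+1) :
  (forall i, d 0 i ^+ p = 1)%R -> exists2 u, u \in diag_torsion & mx u = diag_mx d.
Proof.
move=> dp; have : diag_mx d \in unitmx.
  rewrite unitmxE det_diag unitfE; apply/prodf_neq0 => i _; apply/eqP => d0.
  by have := dp i; rewrite d0 expr0n (gtn_eqF (prime_gt0 p_prime)) => /esym/eqP; rewrite oner_eq0.
by case/GLval_onto=> u uE; exists u => //; apply/diag_torsionP; exists d.
Qed.

Lemma card_diag_torsion : #|diag_torsion| = (p ^ m.+1)%N.
Proof.
have [w w_prim] := exists_prim_root p_prime p_dvd.
(* The p-th roots of unity are the powers of w, so the members of the group correspond to their
   families of exponents. *)
pose f (e : {ffun 'I_m.+1 -> 'I_p}) : 'M[F]_m.+1 := diag_mx (\row_i w ^+ e i)%R.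
have f_inj : injective f.
  move=> e1 e2 /matrixP e12; apply/ffunP=> i; apply/val_inj/eqP.
  have := e12 i i; rewrite !mxE eqxx => /eqP.
  by rewrite (eq_prim_root_expr w_prim) !modn_small.
have -> : (p ^ m.+1)%N = #|codom f| by rewrite card_codom // card_ffun !card_ord.
rewrite -(card_in_imset (in2W GLval_inj)); apply: eq_card => A.
apply/imsetP/codomP => [[u /diag_torsionP[d uE dp] ->] | [e ->]].
  pose e := [ffun i => sval (prim_rootP w_prim (dp i))]; exists e.
  rewrite uE; congr diag_mx; apply/rowP=> i.
  by rewrite !mxE ffunE; case: prim_rootP.
have [|u Du uE] := @diag_torsion_onto (\row_i w ^+ e i)%R; last by exists u.
by move=> i; rewrite mxE exprAC (prim_expr_order w_prim) expr1n.
Qed.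

Lemma pgroup_diag_torsion : p.-group diag_torsion.
Proof. by rewrite /pgroup card_diag_torsion pnatX pnat_id. Qed.

Lemma exists_regular_torsion : m < p ->
  exists2 d : 'rV[F]_m.+1, injective (d 0%R) & forall i, (d 0 i ^+ p = 1)%R.
Proof.
move=> m_lt; have [w w_prim] := exists_prim_root p_prime p_dvd.
exists (\row_i w ^+ i)%R => [i j | i]; rewrite !mxE; last first.
  by rewrite exprAC (prim_expr_order w_prim) expr1n.
move/eqP; rewrite (eq_prim_root_expr w_prim) !modn_small ?(leq_trans _ m_lt) //.
by move/eqP/val_inj.
Qed.

(** Entry (i,j) of the commutation relation reads A_ij (d_j - d_i) = 0. *)
Lemma comm_regular_diag (d : 'rV[F]_m.+1) (A : 'M[F]_m.+1) :
  injective (d 0%R) -> (A *m diag_mx d = diag_mx d *m A)%R -> is_diag_mx A.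
Proof.
move=> d_inj /matrixP AC; apply/is_diag_mxP => i j ij.
have := AC i j; rewrite mul_mx_diag mul_diag_mx !mxE mulrC => /eqP.
rewrite -subr_eq0 -mulrBl mulf_eq0 subr_eq0 => /orP[/eqP/d_inj ji | /eqP //].
by rewrite ji eqxx in ij.
Qed.

End Diagonal.

(** * No redundant Sylow p-subgroup for n < p *)

Section SmallRank.

Variables (p m : nat) (F : finFieldType).
Hypotheses (p_prime : prime p) (p_odd : odd p).
Hypotheses (p_dvd : p %| #|F|.-1) (p2_ndvd : ~~ (p ^ 2 %| #|F|.-1)).

Local Open Scope group_scope.

Lemma GL_lt_not_redundant : m.+1 < p -> ~ has_redundant_Sylow p ('GL_m.+1[F])%G.
Proof.
move=> m_lt [S /properP[sSSyl [P]]]; rewrite inE => sylP PnS cover.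
pose D := diag_torsion_group p m F.
have sylD : p.-Sylow('GL_m.+1[F]) D.
  rewrite pHallE subsetT card_diag_torsion // p_part_GL ?(ltnW m_lt) //.
  by rewrite (ltn_eqF m_lt) addn0 eqxx.
have [g _ PE] := Sylow_trans sylD sylP.
have [d d_inj dp] := exists_regular_torsion p_prime p_dvd (ltnW m_lt).
have [x Dx xE] := diag_torsion_onto p_prime dp.
(* P = D^g is the omitted Sylow subgroup. Its regular element x^g must be covered by some Q in S,
   and the aim is Q = P. *)
have /bigcupP[Q SQ Qxg] : x ^ g \in \bigcup_(Q in S) Q.
  apply: (subsetP cover); rewrite inE in_setT p_eltJ.
  exact: mem_p_elt (pgroup_diag_torsion m p_prime p_dvd) Dx.
have sylQ : p.-Sylow('GL_m.+1[F]) Q by move/(subsetP sSSyl): SQ; rewrite inE.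
have [h _ QE] := Sylow_trans sylD sylQ.
have cQQ : abelian Q by rewrite QE abelianJ; apply: abelian_diag_torsion.
suff sQP : Q \subset P.
  have QP : Q = P.
    by apply/val_inj/eqP; rewrite eqEcard sQP (card_Hall sylP) (card_Hall sylQ) /=.
  by rewrite -QP SQ in PnS.
(* Q is abelian and contains x^g, so u conjugated back by g commutes with x and is diagonal. It has
   exponent p because Q is itself a conjugate of D. *)
apply/subsetP=> u Qu; rewrite PE mem_conjg in_diag_torsion -conjXg; apply/andP; split.
  have : commute (u ^ g^-1) x.
    have := conjgKV g u; move: (u ^ g^-1) => v vE; apply: (conjg_inj g).
    by rewrite !conjMg vE; apply: (centsP cQQ).
  move/(congr1 (@GLval m.+1 F)); rewrite !GL_MxE xE.
  exact: comm_regular_diag.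
have Duh : u ^ h^-1 \in D by rewrite -mem_conjg -QE.
by rewrite -(conjgKV h u) -conjXg (diag_torsionX Duh) !conj1g.
Qed.

End SmallRank.

(** The minimal polynomial of x divides X^p - 1, which splits over F with the distinct roots w^i. *)
Lemma diagonalizable_torsion (p m : nat) (F : finFieldType) :
  prime p -> p %| #|F|.-1 -> forall x : {'GL_m.+1[F]}, (x ^+ p = 1)%g ->
  exists g, x \in (diag_torsion p m F :^ g)%g.
Proof.
move=> p_prime p_dvd x xp; have [w w_prim] := exists_prim_root p_prime p_dvd.
have xpE : ((GLval x : 'M[F]_m.+1) ^+ p = 1)%R by rewrite -GLvalX xp.
have [_ /(_ _) []] := diagonalizableP (GLval x : 'M[F]_m.+1).
  exists [seq w ^+ (i : 'I_p) | i : 'I_p]%R.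
    rewrite map_inj_uniq ?enum_uniq // => i j /eqP.
    by rewrite (eq_prim_root_expr w_prim) !modn_small // => /eqP/val_inj.
  apply: mxminpoly_min; rewrite big_map big_enum /=.
  have -> : (\prod_(i < p) ('X - (w ^+ i)%:P) = 'X^p - 1 :> {poly F})%R.
    by rewrite -(factor_Xn_sub_1 w_prim) big_mkord.
  by rewrite rmorphB rmorphXn rmorph1 /= horner_mx_X xpE subrr.
move=> A uA A_diag; have [g gE] := GLval_onto uA; exists g.
rewrite mem_conjg in_diag_torsion -conjXg xp conj1g eqxx andbT.
move: A_diag; rewrite /similar_to conjumx // -gE.
by rewrite conjgE invgK mulgA !GL_MxE GL_VxE.
Qed.

(** * A Sylow p-subgroup for n = p *)

Section Wreath.

Variables (m : nat) (F : finFieldType).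
Local Notation p := m.+1.
Hypotheses (p_prime : prime p) (p_odd : odd p).
Hypotheses (p_dvd : p %| #|F|.-1) (p2_ndvd : ~~ (p ^ 2 %| #|F|.-1)).

Local Open Scope group_scope.
Local Notation gT := {'GL_m.+1[F]}.
Local Notation mx u := (GLval u : 'M[F]_m.+1).
Local Notation D := (diag_torsion p m F).

(** [ordS] is the successor modulo p, so this is a p-cycle. *)
Definition shift : {perm 'I_p} := perm (@ordS_inj p).

Definition shift_GL : gT := Sub (perm_mx shift : 'M[F]_p) (unitmx_perm F shift).

Local Notation sigma := shift_GL.

Lemma shiftX k (i : 'I_p) : (shift ^+ k) i = (i + k) %% p :> nat.
Proof.
elim: k => [|k IHk]; first by rewrite expg0 perm1 addn0 modn_small.
by rewrite expgSr permM permE /= IHk -addn1 modnDml addn1 addnS.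
Qed.

Lemma GLval_shiftX k : mx (sigma ^+ k) = perm_mx (shift ^+ k).
Proof.
elim: k => [|k IHk]; first by rewrite !expg0 perm_mx1.
by rewrite !expgS GL_MxE IHk perm_mxM.
Qed.

Lemma shiftXp : sigma ^+ p = 1.
Proof.
apply: GLval_inj; rewrite GLval_shiftX; apply: etrans (perm_mx1 _ _).
congr perm_mx; apply/permP=> i; apply: ord_inj.
by rewrite shiftX perm1 modnDr modn_small.
Qed.

(** When p does not divide k, the k-th power of the cycle fixes no index. *)
Lemma diag_shiftX_diag0 d k i : d \in D -> ~~ (p %| k) -> mx (d * sigma ^+ k) i i = 0%R.
Proof.
case/diag_torsionP=> e dE _ pk; rewrite GL_MxE dE GLval_shiftX mul_diag_mx !mxE.
case: eqP => [/(congr1 val)/= | _]; last by rewrite mulr0.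
rewrite shiftX -{2}(modn_small (ltn_ord i)) -{2}[val i]addn0 => /eqP.
by rewrite eqn_modDl mod0n => pk'; rewrite /dvdn pk' in pk.
Qed.

Lemma shift_norm : sigma \in 'N(D).
Proof.
rewrite inE; apply/subsetP=> _ /imsetP[u /diag_torsionP[d uE dp] ->].
(* Conjugation by [sigma] permutes the diagonal entries cyclically; this row is read off from u
   sigma = sigma v at the entries (i, [shift] i). *)
have [|v Dv vE] := @diag_torsion_onto p m F p_prime (\row_j d 0%R (shift^-1 j)).
  by move=> i; rewrite mxE dp.
suff -> : u ^ sigma = v by [].
apply: (mulgI sigma); rewrite -conjgC; apply: GLval_inj.
rewrite !GL_MxE uE vE mul_diag_mx mul_mx_diag; apply/matrixP=> i j.
rewrite !mxE; case: eqP => [<- | _]; last by rewrite mulr0 mul0r.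
by rewrite permK mulrC.
Qed.

(** This is the wreath product of two cyclic groups of order p. *)
Definition wreath_group : {group gT} := (D <*> <[sigma]>)%G.

Local Notation P := wreath_group.

Lemma diag_normal_wreath : D <| P.
Proof. by rewrite normalYl cycle_subG shift_norm. Qed.

Lemma wreathP y : y \in P ->
  y \in D \/ exists d k, [/\ d \in D, ~~ (p %| k) & y = d * sigma ^+ k].
Proof.
rewrite /= norm_joinEr ?cycle_subG ?shift_norm // => /imset2P[d _ Dd /cycleP[k ->] ->].
have [/dvdnP[j ->] | pk] := boolP (p %| k); last by right; exists d, k.
by left; rewrite mulnC expgM shiftXp expg1n mulg1.
Qed.

Lemma shift_in_wreath : sigma \in P.
Proof. by rewrite mem_gen // inE cycle_id orbT. Qed.

Lemma shift_notin_diag : sigma \notin D.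
Proof.
apply/negP=> /diag_torsionP[d sE dp].
have := @diag_shiftX_diag0 1 1 ord0 (group1 _).
rewrite gtnNdvd ?prime_gt1 // mul1g expg1 sE mxE eqxx mulr1n => /(_ isT) d0.
by have := dp ord0; rewrite d0 expr0n => /esym/eqP; rewrite oner_eq0.
Qed.

Lemma pgroup_wreath : p.-group P.
Proof.
rewrite /= norm_joinEr ?cycle_subG ?shift_norm // pgroupM.
rewrite pgroup_diag_torsion //= /pgroup -orderE.
by apply: (@pnat_dvd _ p); [rewrite order_dvdn shiftXp | rewrite pnat_id].
Qed.

Lemma p_part_GL_eq : (#|'GL_p[F]|`_p)%N = (p ^ p.+1)%N.
Proof. by rewrite p_part_GL ?leqnn // eqxx addn1. Qed.

(** The Sylow order bounds the p-group P from above. From below, P properly contains D, of order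
    p^p, and its order is a power of p. *)
Lemma card_wreath : #|P| = (p ^ p.+1)%N.
Proof.
have sDP := normal_sub diag_normal_wreath.
have [Q sylQ sPQ] := Sylow_superset (subsetT P) pgroup_wreath.
apply/eqP; rewrite eqn_leq; apply/andP; split.
  apply: leq_trans (subset_leq_card sPQ) _.
  by rewrite -p_part_GL_eq (card_Hall sylQ).
rewrite (card_pgroup pgroup_wreath) leq_exp2l ?prime_gt1 //.
rewrite -(ltn_exp2l _ _ (prime_gt1 p_prime)) -(card_pgroup pgroup_wreath).
rewrite -(card_diag_torsion m p_prime p_dvd); apply: proper_card.
rewrite properE sDP; apply/subsetPn; exists sigma; [exact: shift_in_wreath |].
exact: shift_notin_diag.
Qed.

Lemma Sylow_wreath : p.-Sylow('GL_p[F]) P.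
Proof.
by rewrite pHallE subsetT card_wreath p_part_GL_eq eqxx.
Qed.

(** Write y = d sigma^k with p not dividing k. As a commutes with d, it commutes with sigma^k, hence
    with [sigma], so its diagonal entries are constant along the p-cycle. *)
Lemma diag_centralizer_wreath a y : a \in D -> y \in P -> y \notin D ->
  commute a y -> exists c : F, mx a = (c%:M)%R.
Proof.
move=> Da /wreathP[-> // | [d [k [Dd pk ->]]]] _ cay.
have : sigma ^+ k \in 'C[a].
  rewrite -(groupMl _ (_ : d \in 'C[a])); first by apply/cent1P.
  by apply/cent1P; exact: diag_torsion_commute Dd Da.
have cop : coprime #|<[sigma]>| k.
  apply: (@coprime_dvdl _ p); first by rewrite -orderE order_dvdn shiftXp.
  by rewrite prime_coprime.
(* Raising sigma^k to the inverse of k modulo the order of [sigma] recovers [sigma]. *)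
move/(groupX (expg_invn <[sigma]> k)); rewrite /= (expgK cop (cycle_id _)).
move/cent1P=> /(congr1 (fun u : gT => mx u)); rewrite !GL_MxE.
case/diag_torsionP: Da => e aE _; rewrite aE mul_diag_mx mul_mx_diag => /matrixP ase.
have e_shift i : e 0%R (shift i) = e 0%R i.
  by have := ase i (shift i); rewrite !mxE eqxx mulr1 mul1r.
exists (e 0%R ord0); rewrite -diag_const_mx; congr diag_mx; apply/rowP=> i; rewrite mxE.
have -> : i = (shift ^+ i) ord0 by apply: ord_inj; rewrite shiftX add0n modn_small.
elim: (val i) => [|j IHj]; first by rewrite expg0 perm1.
by rewrite expgSr permM e_shift.
Qed.

(** A scalar matrix is determined by its first entry, here one of at most p roots of X^p - 1. *)
Lemma card_scalar_diag (B : {group gT}) :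
  B \subset D -> (forall a, a \in B -> exists c : F, mx a = (c%:M)%R) -> #|B| <= p.
Proof.
move=> sBD scal.
have inj : {in B &, injective (fun a : gT => mx a ord0 ord0)}.
  move=> a b /scal[c aE] /scal[c' bE]; rewrite aE bE !mxE eqxx !mulr1n => cc'.
  by apply: GLval_inj; rewrite aE bE cc'.
rewrite -(card_in_imset inj) cardE; apply: max_unity_roots; rewrite ?enum_uniq //.
apply/allP=> z; rewrite mem_enum => /imsetP[a /(subsetP sBD)/diag_torsionP[e aE ep] ->].
by apply/unity_rootP; rewrite aE mxE eqxx mulr1n.
Qed.

(** Suppose B = D^g contains some b outside D. As B is abelian, b centralizes the intersection of B
    and D, which is thus scalar of order at most p. The product BD lies in P, so p^(2p) is at most
    p^(p+2), contradicting p > 2. *)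
Lemma diag_conj_wreath g : D :^ g \subset P -> D :^ g = D.
Proof.
move=> sBP; apply/eqP; rewrite eqEcard cardJg leqnn andbT.
apply/idPn=> /subsetPn[b Bb bnD].
pose D' := diag_torsion_group p m F; pose B := (D' :^ g)%G.
have cBB : abelian B by rewrite abelianJ abelian_diag_torsion.
have sDP := normal_sub diag_normal_wreath.
have BD_le : #|B :&: D'| <= p.
  apply: card_scalar_diag => [|a /setIP[Ba Da]]; first exact: subsetIr.
  apply: (diag_centralizer_wreath Da (subsetP sBP _ Bb) bnD).
  exact: (centsP cBB).
have := mul_cardG B D'; rewrite cardJg card_diag_torsion // -expnD => BDE.
have : p ^ (p + p) <= p ^ (p.+1 + 1).
  rewrite BDE expnD expn1 leq_mul // -card_wreath; apply: subset_leq_card.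
  by rewrite mul_subG.
rewrite leq_exp2l ?prime_gt1 // addn1 -addn2 leq_add2l leqNgt.
by rewrite ltn_neqAle prime_gt1 // andbT negbK => /eqP p2; have := p_odd; rewrite -p2.
Qed.

(** * Every p-element of P lies in another Sylow p-subgroup *)

(* For a p-element [x], [lone x] says that [P] is the only Sylow p-subgroup that contains [x]. *)
Definition lone (x : gT) :=
  forall B : {group gT}, p.-group B -> x \in B -> B \subset P.

Lemma lone_diag_conj x g : lone x -> x \in D :^ g -> D :^ g = D.
Proof.
move=> lone_x xDg; apply: diag_conj_wreath; apply: (lone_x (diag_torsion_group p m F :^ g)%G) => //.
by rewrite pgroupJ pgroup_diag_torsion.
Qed.

Lemma lone_wreath_conj x g : lone x -> x \in P :^ g -> P :^ g = P.
Proof.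
move=> lone_x xPg; apply/eqP; rewrite eqEcard cardJg leqnn andbT.
by apply: (lone_x (P :^ g)%G) => //; rewrite pgroupJ pgroup_wreath.
Qed.

(** The transvection t = 1 + E_ij centralizes x, so if x were lone, t would normalize D, which it
    does not. *)
Lemma not_lone_repeated x (d : 'rV[F]_p) i j :
  x \in D -> mx x = diag_mx d -> i != j -> d 0%R i = d 0%R j -> ~ lone x.
Proof.
move=> Dx xE ij dij lone_x.
pose E : 'M[F]_p := delta_mx i j.
have EE : (E *m E = 0)%R by rewrite mul_delta_mx_cond eq_sym (negPf ij).
have uT : (1%:M + E)%R \in unitmx.
  have /mulmx1_unit[] // : ((1%:M + E) *m (1%:M - E) = 1%:M)%R.
  by rewrite mulmxDl mul1mx mulmxBr mulmx1 EE subr0 subrK.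
have [t tE] := GLval_onto uT.
have xt : x ^ t = x.
  apply: (mulgI t); rewrite -conjgC; apply: GLval_inj.
  rewrite !GL_MxE xE tE mulmxDl mulmxDr mul1mx mulmx1 mul_diag_mx mul_mx_diag.
  congr (_ + _)%R; apply/matrixP=> k l; rewrite !mxE mulrC.
  by case: (eqVneq k i) => [->|_]; case: (eqVneq l j) => [->|_]; rewrite /= ?dij // !mul0r.
have xDt : x \in D :^ t by rewrite -xt memJ_conjg.
have DtD := lone_diag_conj lone_x xDt.
have [w w_prim] := exists_prim_root p_prime p_dvd.
have [|e De eE] := @diag_torsion_onto p m F p_prime (\row_k if k == i then w else 1)%R.
  by move=> k; rewrite mxE; case: ifP => _; rewrite ?expr1n // (prim_expr_order w_prim).
have : e ^ t \in D by rewrite -DtD memJ_conjg.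
case/diag_torsionP=> f fE _.
have := congr1 (@GLval p F) (conjgC e t).
rewrite [LHS]GL_MxE [RHS]GL_MxE eE tE fE mul_diag_mx mul_mx_diag => /matrixP eq_et.
(* With e equal to w at i and 1 elsewhere, the entries (j,j) and (i,j) of e t = t f give f_j = 1 and
   f_j = w. *)
have := eq_et i j; have := eq_et j j; rewrite !mxE !eqxx (negPf ij) eq_sym (negPf ij).
rewrite /= add0r addr0 !mul1r !mulr1 => <- w1.
have := prim_order_dvd w_prim 1; rewrite expr1 w1 eqxx dvdn1.
by rewrite (gtn_eqF (prime_gt1 p_prime)).
Qed.

(** The matrix V with entries d_i^j is invertible and conjugates x to the inverse of [sigma]. If x
    were lone, V would normalize P, hence D, and [sigma] would lie in D. *)
Lemma not_lone_regular x (d : 'rV[F]_p) :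
  x \in D -> mx x = diag_mx d -> injective (d 0%R) -> ~ lone x.
Proof.
move=> Dx xE d_inj lone_x.
have dp i : (d 0 i ^+ p = 1)%R.
  case/diag_torsionP: Dx => e; rewrite xE => de ep.
  by have := congr1 (fun A : 'M_p => A i i) de; rewrite !mxE eqxx !mulr1n => ->.
pose V : 'M[F]_p := (Vandermonde p d)^T%R.
have uV : V \in unitmx.
  rewrite unitmx_tr unitmxE det_Vandermonde unitfE.
  apply/prodf_neq0=> i _; apply/prodf_neq0=> j ij.
  by rewrite subr_eq0; apply: contraTneq ij => /d_inj ->; rewrite ltnn.
have [v vE] := GLval_onto uV.
have xv : x ^ v = sigma^-1.
  apply: (mulgI v); rewrite -conjgC; apply: (mulIg sigma); rewrite mulgKV.
  apply: GLval_inj; rewrite !GL_MxE xE vE.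
  (* Multiplying row i by d_i raises each exponent by one, modulo p since d_i^p = 1: the columns of
     V are shifted cyclically. *)
  have -> : (diag_mx d *m V = V *m perm_mx shift^-1)%R.
    rewrite -col_permE mul_diag_mx; apply/matrixP=> i j; rewrite !mxE -exprS.
    by rewrite permE /= expr_mod.
  by rewrite -mulmxA -perm_mxM mulVg perm_mx1 mulmx1.
have PvP : P :^ v = P.
  have /(lone_wreath_conj lone_x) : x \in P :^ v^-1.
    by rewrite mem_conjgV xv groupV shift_in_wreath.
  by move=> {1}<-; rewrite conjsgKV.
have DvD : D :^ v = D.
  apply: diag_conj_wreath; rewrite -PvP conjSg; exact: normal_sub diag_normal_wreath.
have : sigma^-1 \in D by rewrite -xv -DvD memJ_conjg.
by rewrite groupV (negPf shift_notin_diag).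
Qed.

Lemma not_lone_torsion x : x \in P -> x ^+ p = 1 -> ~ lone x.
Proof.
move=> Px xp lone_x; have [g xDg] := diagonalizable_torsion p_prime p_dvd xp.
have Dx : x \in D by rewrite -(lone_diag_conj lone_x xDg).
have /diag_torsionP[d xE _] := Dx.
have [/injectiveP d_inj | /injectivePn[i [j ij dij]]] := boolP (injectiveb (d 0%R)).
  exact: not_lone_regular d_inj lone_x.
exact: not_lone_repeated ij dij lone_x.
Qed.

Lemma not_lone_nontorsion x : x \in P -> x ^+ p != 1 -> ~ lone x.
Proof.
move=> Px xp1 lone_x.
have nsDP := diag_normal_wreath.
have xnD : x \notin D by apply: contra xp1 => /diag_torsionX ->.
have x0 i : mx x i i = 0%R.
  have [Dx | [d [k [Dd pk ->]]]] := wreathP Px; first by rewrite Dx in xnD.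
  exact: diag_shiftX_diag0.
have Nx : x \in 'N(D) by apply: subsetP Px; apply: normal_norm.
(* The quotient P / D has order p. *)
have Dxp : x ^+ p \in D.
  apply: coset_idr; rewrite ?groupX // morphX //.
  have PD : #|P / D| = p.
    rewrite card_quotient ?normal_norm // -divgS ?normal_sub //.
    by rewrite card_wreath card_diag_torsion // expnS mulnK // expn_gt0.
  by apply/eqP; rewrite -order_dvdn -[X in _ %| X]PD order_dvdG // mem_quotient.
have [c xpE] : exists c : F, mx (x ^+ p) = (c%:M)%R.
  by apply: diag_centralizer_wreath Px xnD _ => //; apply/commute_sym/commuteX.
(* The geometric sum S satisfies (x - 1) S = x^p - 1 = c - 1, a nonzero scalar. *)
have uG : (mx x - 1%:M)%R \in unitmx.
  have c1 : (c - 1 != 0)%R.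
    rewrite subr_eq0; apply: contraNneq xp1 => c1.
    by apply/eqP/GLval_inj; rewrite xpE c1.
  have := subrXX_comm p (commr1 (mx x)); rewrite expr1n -GLvalX xpE.
  set S := (\sum_(i < p) _)%R => cE.
  have /mulmx1_unit[] // : ((mx x - 1%:M) *m ((c - 1)^-1 *: S) = 1%:M)%R.
  have c1E : ((c - 1)%:M = c%:M - 1 :> 'M[F]_p)%R by rewrite raddfB.
  by rewrite -scalemxAr -[X in (_ *: X)%R]cE -c1E scale_scalar_mx mulVf.
have [g gE] := GLval_onto uG.
have gx : x ^ g = x.
  apply: (mulgI g); rewrite -conjgC; apply: GLval_inj.
  by rewrite !GL_MxE gE mulmxBl mulmxBr mul1mx mulmx1.
have PgP : P :^ g = P by apply: (lone_wreath_conj lone_x); rewrite -gx memJ_conjg.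
have DgD : D :^ g = D.
  by apply: diag_conj_wreath; rewrite -PgP conjSg normal_sub.
(* Compare diagonals in a (x - 1) = (x - 1) a^g: since x has zero diagonal, a^g = a. Thus x
   centralizes D, so it is diagonal with zero diagonal, which is absurd. *)
have cDx a : a \in D -> (mx x *m mx a = mx a *m mx x)%R.
  move=> Da; have : a ^ g \in D by rewrite -DgD memJ_conjg.
  case/diag_torsionP: Da => d aE _ /diag_torsionP[f fE _].
  have := congr1 (@GLval p F) (conjgC a g).
  rewrite [LHS]GL_MxE [RHS]GL_MxE aE gE fE mulmxBr mulmxBl mulmx1 mul1mx => agE.
  have df : d = f.
    apply/rowP=> i; move/matrixP/(_ i i): (agE).
    rewrite mul_diag_mx mul_mx_diag !mxE !x0 mulr0 mul0r !sub0r eqxx !mulr1n.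
    exact: oppr_inj.
  by move: agE; rewrite df => /addIr.
have [d d_inj dp] := exists_regular_torsion p_prime p_dvd (leqnn p).
have [a Da aE] := diag_torsion_onto p_prime dp.
have := cDx a Da; rewrite aE => /(comm_regular_diag d_inj)/diag_mxP[e xE].
have : (mx x = 0)%R.
  rewrite xE; apply/matrixP=> i j; rewrite !mxE; case: eqP => // _.
  by have := x0 i; rewrite xE mxE eqxx.
by move=> x00; have := GL_det x; rewrite x00 det0 eqxx.
Qed.

Lemma GL_prime_redundant : has_redundant_Sylow p ('GL_p[F])%G.
Proof.
have sylP := Sylow_wreath.
exists ('Syl_p('GL_p[F]%G) :\ P).
  by apply: properD1; rewrite inE.
apply/subsetP=> x; rewrite inE => /andP[_ px]; apply: contraT => xnU.
have lone_x : lone x.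
  move=> B pB Bx; have [Q sylQ sBQ] := Sylow_superset (subsetT B) pB.
  have [<- // | QP] := eqVneq Q P.
  case/bigcupP: xnU; exists Q; last exact: (subsetP sBQ).
  by rewrite !inE QP.
have Px : x \in P.
  apply: (subsetP (lone_x <[x]>%G px (cycle_id x))); exact: cycle_id.
have [xp | xp] := eqVneq (x ^+ p) 1; first by case: (not_lone_torsion Px xp).
by case: (not_lone_nontorsion Px xp).
Qed.

End Wreath.

Theorem theorem5p1 (p : nat) (F : finFieldType) :
  prime p -> odd p ->
  p %| #|F|.-1 -> ~~ (p ^ 2 %| #|F|.-1) ->
  (forall n : nat, 1 < n < p -> ~ has_redundant_Sylow p ('GL_n[F])%G) /\
  has_redundant_Sylow p ('GL_p[F])%G.
Proof.
move=> p_prime p_odd p_dvd p2_ndvd; split.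
  by case=> // m /andP[_ m_lt]; apply: GL_lt_not_redundant.
by case: p p_prime p_odd p_dvd p2_ndvd => // m *; apply: GL_prime_redundant.
Qed.
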